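(* There exists an infinite family of (pairwise non-isomorphic) finite simple regular graphs with diameter $3$, each of which admits a $\{1,2\}$-distance magic labeling.
   Context: Let $G=(V,E)$ be a finite simple undirected graph with $v=|V|$ vertices, and let $d(x,y)$ be the graph distance. For a set $D$ of nonnegative integers and $x\in V$, put $N_D(x)=\{y\in V : d(x,y)\in D\}$. A $D$-distance magic labeling of $G$ is a bijection $f:V\to\{1,2,\ldots,v\}$ for which there is a constant $\mathsf{k}$ such that $\sum_{y\in N_D(x)} f(y)=\mathsf{k}$ for every $x\in V$. A graph is regular if all its vertices have the same degree. Diameter $3$ means the graph is connected and the maximum distance between two vertices is $3$. *)

(* Defs.v *)
From mathcomp Require Import all_boot.

Set Implicit Arguments.
Unset Strict Implicit.
Unset Printing Implicit Defensive.

Record sgraph := SGraph {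
  vertex :> finType;
  adj : rel vertex;
  adj_sym : symmetric adj;
  adj_irrefl : irreflexive adj
}.

Definition sgraph_iso (G H : sgraph) : Prop :=
  exists2 h : G -> H, bijective h & forall x y, adj (h x) (h y) = adj x y.

Definition regular (G : sgraph) : Prop :=
  exists r : nat, forall x : G, #|[set y | adj x y]| = r.

Definition connected (G : sgraph) : Prop :=
  forall x y : G, connect (@adj G) x y.

Definition walk (G : sgraph) (x y : G) (k : nat) : bool :=
  [exists p : k.-tuple G, path (@adj G) x p && (last x p == y)].

Lemma connect_walk (G : sgraph) (x y : G) :
  connect (@adj G) x y -> exists k, walk x y k.
Proof.
case/connectP=> p xp ->; exists (size p).
by apply/existsP; exists (in_tuple p); rewrite xp /=.
Qed.

(* The least length of a walk from x to y; None stands for infinity, when x   *)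
(* and y lie in different components.                                         *)
Definition dist (G : sgraph) (x y : G) : option nat :=
  if @decP (connect (@adj G) x y) _ idP is left xy
  then Some (ex_minn (connect_walk xy)) else None.

Definition has_diameter (G : sgraph) (d : nat) : Prop :=
  [/\ connected G,
      forall (x y : G) (k : nat), dist x y = Some k -> k <= d &
      exists x y : G, dist x y = Some d].

Definition dist_nbhd (G : sgraph) (D : {pred nat}) (x : G) : {set G} :=
  [set y | if dist x y is Some k then k \in D else false].

Definition magic_labeling (G : sgraph) (D : {pred nat}) (f : G -> nat) : Prop :=
  [/\ forall x, 1 <= f x <= #|G|,
      injective f,
      forall i, 1 <= i <= #|G| -> exists x, f x = i &
      exists k : nat, forall x, \sum_(y in dist_nbhd D x) f y = k].

(* Main.v *)
Require Import Defs.
From mathcomp Require Import all_boot.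
From mathcomp Require Import zify.

(** In a graph of diameter 3 the vertices at distance 1 or 2 from [x] are all
    the vertices except [x] itself and those at distance 3 from [x].  Suppose
    that every [x] has exactly one vertex [x'] at distance 3.  Then a labeling
    by [1 .. v] in which the pairs [x], [x'] all have the same label sum is
    {1,2}-distance magic, with constant the total of the labels minus that
    common sum ([sum_dist_nbhd_antipodal]); and pairing [i] with [v + 1 - i]
    gives such a labeling.

    The crown graphs, that is, the complete bipartite graphs [K_(m,m)] with a
    perfect matching removed, have this property for every [m > 2]: two
    vertices on the same side have distance 2, since a third index gives a
    common neighbour, and parity together with the missing edge puts the
    two ends of a matching edge at distance 3 ([crown_dist]).  They are
    regular of degree [m - 1], and their orders [2 m] tell them apart. *)

Set Implicit Arguments.
Unset Strict Implicit.
Unset Printing Implicit Defensive.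

(** * Walks and distance *)

Lemma walk0 (G : sgraph) (x y : G) : walk x y 0 = (x == y).
Proof.
apply/existsP/eqP => [[p]|->]; first by rewrite tuple0 /= => /eqP.
by exists [tuple]; rewrite /= eqxx.
Qed.

Lemma walkS (G : sgraph) (x y : G) k :
  walk x y k.+1 = [exists z, adj x z && walk z y k].
Proof.
apply/existsP/existsP => [[p]|[z /andP[xz /existsP[p zp]]]].
  case/tupleP: p => z p /=; rewrite -andbA => /andP[xz zp].
  by exists z; rewrite xz; apply/existsP; exists p.
by exists [tuple of z :: p]; rewrite /= xz.
Qed.

Lemma walk1 (G : sgraph) (x y : G) : walk x y 1 = adj x y.
Proof.
rewrite walkS; apply/existsP/idP => [[z]|xy].
  by rewrite walk0 => /andP[xz /eqP <-].
by exists y; rewrite xy walk0 eqxx.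
Qed.

Lemma walk_cons (G : sgraph) (x z y : G) k :
  adj x z -> walk z y k -> walk x y k.+1.
Proof. by move=> xz zy; rewrite walkS; apply/existsP; exists z; rewrite xz. Qed.

Lemma walk_connect (G : sgraph) (x y : G) k :
  walk x y k -> connect (@adj G) x y.
Proof.
by case/existsP=> p /andP[xp /eqP <-]; apply/connectP; exists p.
Qed.

Lemma dist_shortest_walk (G : sgraph) (x y : G) k :
  walk x y k -> (forall j, j < k -> ~~ walk x y j) -> dist x y = Some k.
Proof.
move=> xy_k shortest; rewrite /dist; case: decP => [xy|[]]; last first.
  exact: walk_connect xy_k.
congr Some; case: ex_minnP => j xy_j /(_ k xy_k) le_jk.
apply/eqP; rewrite eqn_leq le_jk leqNgt; apply: contraL xy_j.
exact: shortest.
Qed.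

Lemma dist_connected (G : sgraph) (x y : G) k :
  dist x y = Some k -> connect (@adj G) x y.
Proof. by rewrite /dist; case: decP. Qed.

(** * Labelings that balance antipodal pairs *)

(** Removing a pair of constant weight from the whole vertex set leaves a
    constant weight. *)
Lemma sum_dist_nbhd_antipodal (G : sgraph) (D : {pred nat}) (opp : G -> G)
    (f : G -> nat) (c : nat) :
    (forall x, dist_nbhd D x = ~: [set x; opp x]) ->
    (forall x, opp x != x) -> (forall x, f x + f (opp x) = c) ->
  forall x, \sum_(y in dist_nbhd D x) f y = \sum_y f y - c.
Proof.
move=> nbhdE opp_neq f_opp x; rewrite nbhdE.
rewrite [in RHS](bigID (mem [set x; opp x])) /= big_setU1 ?inE 1?eq_sym //=.
rewrite big_set1 f_opp addKn.
by apply: eq_bigl => y; rewrite inE.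
Qed.

(** * Crown graphs *)

Definition crown_adj m : rel (bool * 'I_m) :=
  fun x y => (x.1 != y.1) && (x.2 != y.2).

Lemma crown_adj_sym m : symmetric (@crown_adj m).
Proof. by move=> x y; rewrite /crown_adj ![y.1 == _]eq_sym ![y.2 == _]eq_sym. Qed.

Lemma crown_adj_irrefl m : irreflexive (@crown_adj m).
Proof. by move=> x; rewrite /crown_adj eqxx. Qed.

Definition crown m := SGraph (@crown_adj_sym m) (@crown_adj_irrefl m).

Definition crown_opp m (x : crown m) : crown m := (~~ x.1, x.2).

Lemma card_crown m : #|crown m| = m.*2.
Proof. by rewrite card_prod card_bool card_ord mul2n. Qed.

Lemma crown_regular m : regular (crown m).
Proof.
exists m.-1 => -[s i].
have -> : [set y | adj ((s, i) : crown m) y] = setX [set ~~ s] [set~ i].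
  apply/setP=> -[t j]; rewrite !inE /= /crown_adj /= [j == i]eq_sym.
  by case: s; case: t.
by rewrite cardsX cards1 cardsC1 card_ord mul1n.
Qed.

Lemma crown_walk_parity m k (x y : crown m) :
  walk x y k -> x.1 (+) y.1 = odd k.
Proof.
elim: k x => [|k IHk] x; first by rewrite walk0 => /eqP ->; rewrite addbb.
rewrite walkS => /existsP[z /andP[/andP[neq_xz _] /IHk /= <-]].
by move: neq_xz; case: x.1; case: z.1; case: y.1.
Qed.

Lemma ord_avoid2 m (i j : 'I_m) :
  2 < m -> exists k : 'I_m, (i != k) && (j != k).
Proof.
move=> m_gt2; have /card_gt0P[k] : 0 < #|~: [set i; j]|.
  by rewrite cardsCs setCK card_ord cards2; case: (i != j); lia.
by rewrite !inE negb_or => /andP[ki kj]; exists k; rewrite !(eq_sym _ k) ki.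
Qed.

Definition crown_distance m (x y : crown m) : nat :=
  if x.1 == y.1 then (if x.2 == y.2 then 0 else 2)
  else (if x.2 == y.2 then 3 else 1).

(** Distinct vertices that are not adjacent are joined through indices other
    than their own, which exist since [m > 2].  Shorter walks are excluded
    because those of length 0 or 1 are equalities or edges, and one of length 2
    would not change sides. *)
Lemma crown_dist m (x y : crown m) :
  2 < m -> dist x y = Some (crown_distance x y).
Proof.
move=> m_gt2; case: x y => [s i] [t j]; rewrite /crown_distance /=.
have [k /andP[ik jk]] := ord_avoid2 i j m_gt2.
have adjE u v a b : adj ((u, a) : crown m) (v, b) = (u != v) && (a != b) by [].
have [<-|neq_st] := eqVneq s t; have [<-|neq_ij] := eqVneq i j => /=.
- by apply: dist_shortest_walk; rewrite ?walk0.
- apply: dist_shortest_walk => [|[|[|//]] _].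
  + apply: (@walk_cons (crown m) _ (~~ s, k)); first by rewrite adjE ik; case: (s).
    by rewrite walk1 adjE (eq_sym k) jk; case: (s).
  + by rewrite walk0; apply: contra neq_ij => /eqP[->].
  + by rewrite walk1 adjE eqxx.
- have [l /andP[il kl]] := ord_avoid2 i k m_gt2.
  apply: dist_shortest_walk => [|[|[|[|//]]] _].
  + apply: (@walk_cons (crown m) _ (t, k)); first by rewrite adjE neq_st.
    apply: (@walk_cons (crown m) _ (s, l)); first by rewrite adjE eq_sym neq_st.
    by rewrite walk1 adjE neq_st eq_sym.
  + by rewrite walk0; apply: contra neq_st => /eqP[->].
  + by rewrite walk1 adjE eqxx andbF.
  + by apply: contra neq_st => /crown_walk_parity /=; case: (s); case: (t).
- apply: dist_shortest_walk => [|[|//] _]; first by rewrite walk1 adjE neq_st.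
  by rewrite walk0; apply: contra neq_st => /eqP[->].
Qed.

Lemma crown_diameter m : 2 < m -> has_diameter (crown m) 3.
Proof.
move=> m_gt2; split=> [x y|x y k|].
- exact: dist_connected (crown_dist x y m_gt2).
- by rewrite crown_dist // => -[<-]; rewrite /crown_distance; do 2!case: ifP.
- have i : 'I_m by exists 0; lia.
  by exists (true, i), (false, i); rewrite crown_dist // /crown_distance /= eqxx.
Qed.

Lemma crown_dist_nbhd12 m (x : crown m) :
  2 < m -> dist_nbhd (pred2 1 2) x = ~: [set x; crown_opp x].
Proof.
move=> m_gt2; apply/setP=> y; rewrite !inE crown_dist // /crown_distance.
case: x y => [s i] [t j]; rewrite /crown_opp !xpair_eqE /= [j == i]eq_sym.
by case: s; case: t; case: (i == j).
Qed.

Definition crown_label m (x : crown m) : nat :=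
  if x.1 then x.2.+1 else m.*2 - x.2.

Lemma crown_label_opp m (x : crown m) :
  crown_label x + crown_label (crown_opp x) = m.*2.+1.
Proof. by case: x => -[] i; rewrite /crown_label /=; have := ltn_ord i; lia. Qed.

Lemma crown_label_inj m : injective (@crown_label m).
Proof.
move=> [s i] [t j]; rewrite /crown_label /= => eq_lab.
have [im jm] := (ltn_ord i, ltn_ord j).
have eq_st : s = t by case: s t eq_lab => -[] //=; lia.
by rewrite -eq_st in eq_lab *; congr pair; apply: val_inj => /=;
  case: s eq_lab {eq_st}; lia.
Qed.

Lemma crown_label_surj m k :
  1 <= k <= m.*2 -> exists x : crown m, crown_label x = k.
Proof.
move=> k_bounds; have [le_km|lt_mk] := leqP k m.
  have lt_m : k.-1 < m by lia.
  by exists (true, Ordinal lt_m); rewrite /crown_label /=; lia.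
have lt_m : m.*2 - k < m by lia.
by exists (false, Ordinal lt_m); rewrite /crown_label /=; lia.
Qed.

Lemma crown_magic m : 2 < m -> magic_labeling (pred2 1 2) (@crown_label m).
Proof.
move=> m_gt2; split; rewrite ?card_crown.
- by case=> s i; rewrite /crown_label; have := ltn_ord i; case: s => /=; lia.
- exact: crown_label_inj.
- exact: crown_label_surj.
- eexists; apply: sum_dist_nbhd_antipodal (@crown_label_opp m) => x.
    exact: crown_dist_nbhd12.
  by case: x => -[] i; rewrite xpair_eqE.
Qed.

Lemma crown_iso_eq m n : sgraph_iso (crown m) (crown n) -> m = n.
Proof.
by case=> h /bij_eq_card; rewrite !card_crown => /double_inj.
Qed.

Theorem theorem13 :
  exists G : nat -> sgraph,
    (forall n : nat,
       [/\ regular (G n), has_diameter (G n) 3 &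
           exists f : G n -> nat, magic_labeling (pred2 1 2) f]) /\
    (forall m n : nat, m <> n -> ~ sgraph_iso (G m) (G n)).
Proof.
exists (fun n => crown n.+3); split=> [n|m n neq_mn /crown_iso_eq[]//].
split; [exact: crown_regular | exact: crown_diameter |].
by exists (@crown_label n.+3); apply: crown_magic.
Qed.
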